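(* Let $(\Omega,\mathcal F,\mu)$ be a measure space, let $1<p<\infty$, and let $T\colon L^p(\Omega)\to L^p(\Omega)$ be a positive operator. If $T$ is absolutely Cesàro bounded, then $T$ is $p$-absolutely Cesàro bounded. Moreover, there exists a constant $C_p>0$, depending only on $p$ (and not on $\Omega$ or $T$), such that $$C_{p,\mathrm{ac}}(T)\le C_p\, C_{1,\mathrm{ac}}(T)^{2p}.$$
   Context: For a Banach space $X$, $\mathcal L(X)$ is the space of bounded linear operators on $X$. For $r>0$, $T\in\mathcal L(X)$ is $r$-absolutely Cesàro bounded ($r$-ACB) if there is $C>0$ such that $\sup_{n\ge1}\frac1n\sum_{k=0}^{n-1}\|T^kx\|^r\le C\|x\|^r$ for all $x\in X$; $C_{r,\mathrm{ac}}(T)$ denotes the smallest such constant. ''Absolutely Cesàro bounded'' (ACB) means $1$-ACB. An operator $T\in\mathcal L(L^p(\Omega))$ is positive if $Tf\ge0$ whenever $f\ge 0$. *)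

(* Defs.v *)
From HB Require Import structures.
From mathcomp Require Import all_boot all_order all_algebra.
From mathcomp Require Import generic_quotient ring_quotient complex.
From mathcomp Require Import all_classical all_reals all_analysis measurable_realfun.

Set Implicit Arguments.
Unset Strict Implicit.
Unset Printing Implicit Defensive.

Import Order.TTheory GRing.Theory Num.Theory numFieldNormedType.Exports.

Local Open Scope classical_set_scope.
Local Open Scope ring_scope.

Variant scalar_kind := RealScalars | ComplexScalars.

(* In the ordering of [complex R], [0 <= z] says that [z] is real and
   nonnegative; the norm [`|z|] is a scalar too, and [modulus z] is the same
   number as an element of [R]. *)
Section Scalars.
Context {R : realType}.

Definition scalar (k : scalar_kind) : numFieldType :=
  match k with RealScalars => R | ComplexScalars => complex R end.

Definition reS {k} : scalar k -> R :=
  match k return scalar k -> R with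
  | RealScalars => idfun
  | ComplexScalars => @complex.Re R
  end.

Definition imS {k} : scalar k -> R :=
  match k return scalar k -> R with
  | RealScalars => cst 0
  | ComplexScalars => @complex.Im R
  end.

Definition ofS {k} : R -> scalar k :=
  match k return R -> scalar k with
  | RealScalars => idfun
  | ComplexScalars => real_complex R
  end.

Definition modulus {k} (z : scalar k) : R := reS `|z|.

End Scalars.
Arguments scalar R k : clear implicits.

Section ScalarFacts.
Context {R : realType} {k : scalar_kind}.
Implicit Types z w : scalar R k.

Lemma reSD z w : reS (z + w) = reS z + reS w.
Proof. by case: k z w => //= -[? ?] [? ?]. Qed.

Lemma imSD z w : imS (z + w) = imS z + imS w.
Proof. by case: k z w => [z w|[? ?] [? ?]] //=; rewrite addr0. Qed.

Lemma reSM z w : reS (z * w) = reS z * reS w - imS z * imS w.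
Proof. by case: k z w => [z w|[? ?] [? ?]] //=; rewrite mulr0 subr0. Qed.

Lemma imSM z w : imS (z * w) = reS z * imS w + imS z * reS w.
Proof. by case: k z w => [z w|[? ?] [? ?]] //=; rewrite mulr0 mul0r addr0. Qed.

Lemma reS0 : reS (0 : scalar R k) = 0. Proof. by case: k. Qed.

Lemma imS0 : imS (0 : scalar R k) = 0. Proof. by case: k. Qed.

Lemma ofSK : cancel (@ofS R k) reS. Proof. by case: k. Qed.

Lemma ofSD (a b : R) : ofS (a + b) = ofS a + ofS b :> scalar R k.
Proof. by case: k => //=; rewrite rmorphD. Qed.

Lemma ofSM (a b : R) : ofS (a * b) = ofS a * ofS b :> scalar R k.
Proof. by case: k => //=; rewrite rmorphM. Qed.

Lemma ofS0 : ofS 0 = 0 :> scalar R k. Proof. by case: k. Qed.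

Lemma ler_ofS (a b : R) : (ofS a <= ofS b :> scalar R k) = (a <= b).
Proof. by case: k => //=; rewrite lecR. Qed.

Lemma modulusE z : modulus z = Num.sqrt (reS z ^+ 2 + imS z ^+ 2).
Proof.
rewrite /modulus; case: k z => [z|z] /=; last by case: z.
by rewrite expr0n addr0 sqrtr_sqr.
Qed.

Lemma ofS_modulus z : ofS (modulus z) = `|z|.
Proof. by rewrite /modulus; case: k z. Qed.

Lemma modulus_ge0 z : 0 <= modulus z.
Proof. by rewrite modulusE sqrtr_ge0. Qed.

Lemma ler_modulusD z w : modulus (z + w) <= modulus z + modulus w.
Proof. by rewrite -ler_ofS ofSD !ofS_modulus ler_normD. Qed.

Lemma modulusM z w : modulus (z * w) = modulus z * modulus w.
Proof. by apply: (can_inj ofSK); rewrite ofSM !ofS_modulus normrM. Qed.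

Lemma modulus0 : modulus (0 : scalar R k) = 0.
Proof. by rewrite /modulus normr0 reS0. Qed.

Lemma modulus0_eq0 z : modulus z = 0 -> z = 0.
Proof. by move=> z0; apply/normr0_eq0; rewrite -ofS_modulus z0 ofS0. Qed.

End ScalarFacts.

Section PreLp.
Context {R : realType} (k : scalar_kind) {d : measure_display}
  {Omega : measurableType d} (mu : {measure set Omega -> \bar R}) (p : R).
Implicit Types f g : Omega -> scalar R k.

Definition pnorm f : \bar R := 'N[mu]_p%:E[EFin \o (fun x => modulus (f x))]%E.

Definition measurableS f : Prop :=
  measurable_fun setT (fun x => reS (f x)) /\
  measurable_fun setT (fun x => imS (f x)).

(* The argument [1 <= p] makes the closure properties below inferable. *)
Definition preLp_pred of 1 <= p : {pred Omega -> scalar R k} :=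
  mem [set f | measurableS f /\ (pnorm f < +oo)%E].

Hypothesis p1 : 1 <= p.

Let p0 : 0 < p. Proof. exact: lt_le_trans ltr01 p1. Qed.

Lemma measurable_modulus f : measurableS f ->
  measurable_fun setT (fun x => modulus (f x)).
Proof.
case=> mr mi.
rewrite (_ : (fun _ => _) =
  Num.sqrt \o (fun x => reS (f x) ^+ 2 + imS (f x) ^+ 2)); last first.
  by apply/funext => x /=; rewrite modulusE.
apply: measurableT_comp.
  by apply: continuous_measurable_fun; exact: sqrt_continuous.
by apply: measurable_funD; exact: measurable_funX.
Qed.

Lemma measurable_modulus_powR f : measurableS f ->
  measurable_fun setT (fun x => (modulus (f x) `^ p)%:E).
Proof.
move=> mf; apply/measurable_EFinP.
exact: (measurableT_comp (measurable_powR _) (measurable_modulus mf)).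
Qed.

Lemma pnormE f :
  pnorm f = ((\int[mu]_x (modulus (f x) `^ p)%:E) `^ p^-1)%E.
Proof.
rewrite /pnorm unlock; congr (_ `^ _)%E; apply: eq_integral => x _ /=.
by rewrite (ger0_norm (modulus_ge0 _)).
Qed.

Lemma pnorm0 : pnorm 0 = 0%E.
Proof.
rewrite /pnorm (_ : EFin \o _ = cst 0%E) ?Lnorm0 ?eqe ?gt_eqF//.
by apply/funext => x /=; rewrite modulus0.
Qed.

Lemma pnormZ a f : measurableS f ->
  pnorm (a *: f) = ((modulus a)%:E * pnorm f)%E.
Proof.
move=> mf; rewrite !pnormE.
have aE x : modulus ((a *: f) x) = modulus a * modulus (f x) by rewrite -modulusM.
under eq_integral do
  rewrite aE (powRM _ (modulus_ge0 _) (modulus_ge0 _)) EFinM.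
rewrite ge0_integralZl_EFin ?powR_ge0//; first last.
- exact: measurable_modulus_powR.
- by move=> x _; rewrite lee_fin powR_ge0.
rewrite poweRM ?lee_fin ?powR_ge0 ?integral_ge0//; last first.
  by move=> x _; rewrite lee_fin powR_ge0.
by rewrite poweR_EFin -powRrM mulfV ?gt_eqF// powRr1 ?modulus_ge0.
Qed.

Lemma pnormD f g : measurableS f -> measurableS g ->
  (pnorm (f + g)%R <= pnorm f + pnorm g)%E.
Proof.
move=> mf mg.
have mM := measurable_modulus; set h : Omega -> R := fun x => modulus (f x) + modulus (g x).
have mh : measurable_fun setT h by apply: measurable_funD; exact: mM.
have h0 x : 0 <= h x by rewrite addr_ge0 ?modulus_ge0.
apply: (@le_trans _ _ ('N[mu]_p%:E[EFin \o h])%E); last first.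
  by have := minkowski_EFin mu (mM f mf) (mM g mg) p1.
have mfg : measurableS (f + g).
  case: mf mg => mfr mfi [mgr mgi]; split.
    by under eq_fun do rewrite reSD; exact: measurable_funD.
  by under eq_fun do rewrite imSD; exact: measurable_funD.
rewrite pnormE unlock.
apply: gt0_ler_poweR; rewrite ?invr_ge0 ?(ltW p0)// ?in_itv/= ?leey ?andbT.
- by apply: integral_ge0 => x _; rewrite lee_fin powR_ge0.
- by apply: integral_ge0 => x _; rewrite lee_fin powR_ge0.
apply: ge0_le_integral => //=.
- by move=> x _; rewrite lee_fin powR_ge0.
- exact: measurable_modulus_powR.
- under eq_fun do rewrite ger0_norm//; apply/measurable_EFinP.
  exact: (measurableT_comp (measurable_powR _) mh).
move=> x _; rewrite ger0_norm// lee_fin ge0_ler_powR ?(ltW p0)// ?nnegrE ?modulus_ge0//.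
exact: ler_modulusD.
Qed.

Lemma pnorm_eq0 f : measurableS f -> pnorm f = 0%E -> f = 0 %[ae mu].
Proof.
move=> mf /Lnorm_eq0_eq0; rewrite lte_fin.
have /measurable_EFinP me := measurable_modulus mf.
move=> /(_ me p0); apply: filterS => x /= /(_ I) [] fx0 _.
exact: modulus0_eq0.
Qed.

Lemma ae_eq_pnorm f g : measurableS f -> measurableS g ->
  f = g %[ae mu] -> pnorm f = pnorm g.
Proof.
move=> mf mg fg; rewrite !pnormE; congr (_ `^ _)%E.
apply: ge0_ae_eq_integral => //.
- exact: measurable_modulus_powR.
- exact: measurable_modulus_powR.
- by move=> x _; rewrite lee_fin powR_ge0.
- by move=> x _; rewrite lee_fin powR_ge0.
by apply: filterS fg => x /= /[apply] ->.
Qed.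

Lemma preLp_submod_closed : submod_closed (preLp_pred p1).
Proof.
split.
  rewrite inE; split; last by rewrite pnorm0.
  split.
    rewrite (_ : (fun _ => _) = cst 0)//; apply/funext => x; exact: reS0.
  rewrite (_ : (fun _ => _) = cst 0)//; apply/funext => x; exact: imS0.
move=> a f g; rewrite !inE => -[mf ff] [mg fg].
have maf : measurableS (a *: f).
  case: mf => mr mi; split.
    under eq_fun do rewrite reSM.
    by apply: measurable_funB; exact: measurable_funM.
  under eq_fun do rewrite imSM.
  by apply: measurable_funD; exact: measurable_funM.
split.
  case: maf mg => mfr mfi [mgr mgi]; split.
    by under eq_fun do rewrite reSD; exact: measurable_funD.
  by under eq_fun do rewrite imSD; exact: measurable_funD.
apply: le_lt_trans (pnormD maf mg) _; rewrite lte_add_pinfty//.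
by rewrite pnormZ// lte_mul_pinfty ?lee_fin ?modulus_ge0.
Qed.

HB.instance Definition _ := GRing.isSubmodClosed.Build _ _ (preLp_pred p1)
  preLp_submod_closed.

Record preLp := PreLp {
  preLp_fun :> Omega -> scalar R k;
  preLp_in : preLp_fun \in preLp_pred p1 }.

HB.instance Definition _ := [isSub for preLp_fun].
HB.instance Definition _ := gen_eqMixin preLp.
HB.instance Definition _ := gen_choiceMixin preLp.
HB.instance Definition _ := [SubChoice_isSubLmodule of preLp by <:].

Lemma preLpP (f : preLp) : measurableS f /\ (pnorm f < +oo)%E.
Proof. by have := preLp_in f; rewrite inE. Qed.

Definition null_pred : {pred preLp} :=
  mem [set f : preLp | (f : Omega -> scalar R k) = 0 %[ae mu]].

Lemma null_zmod_closed : zmod_closed null_pred.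
Proof.
split=> [|f g]; rewrite !inE; first exact: aeW.
move=> f0 g0; apply: filterS2 f0 g0 => x f0 g0 _.
have -> : (f - g : preLp) x = f x - g x by [].
by rewrite f0// g0// subr0.
Qed.

HB.instance Definition _ := GRing.isZmodClosed.Build preLp null_pred
  null_zmod_closed.

Definition Lp : Type := Quotient.quot null_pred.

HB.instance Definition _ := GRing.Zmodule.on Lp.
HB.instance Definition _ := EqQuotient.on Lp.

Definition Lp_fun (f : Lp) : Omega -> scalar R k := repr f.
Coercion Lp_fun : Lp >-> Funclass.

Local Notation piLp := (\pi_Lp%qT : preLp -> Lp).

Lemma piLp_eq (f g : preLp) :
  piLp f = piLp g <-> (f : Omega -> scalar R k) = g %[ae mu].
Proof.
have subE x : (f - g : preLp) x = f x - g x by [].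
split=> [/eqP|fg].
  rewrite -Quotient.idealrBE inE; apply: filterS => x /(_ I) fg0 _.
  by apply/eqP; rewrite -subr_eq0 -subE; exact/eqP.
apply/eqP; rewrite -Quotient.idealrBE inE; apply: filterS fg => x /(_ I) fg _.
by rewrite subE fg subrr.
Qed.

Lemma Lp_fun_pi (f : preLp) : (piLp f : Omega -> scalar R k) = f %[ae mu].
Proof. by apply/piLp_eq; rewrite reprK. Qed.

Lemma LpP (f g : Lp) : f = g <-> (f : Omega -> scalar R k) = g %[ae mu].
Proof. by rewrite -piLp_eq !reprK. Qed.

Lemma piLpD (f g : preLp) : piLp (f + g) = piLp f + piLp g.
Proof. exact: Quotient.pi_add. Qed.

Lemma piLp0 : piLp 0 = 0.
Proof. by apply: (addrI (piLp 0)); rewrite -piLpD !addr0. Qed.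

Lemma Lp_funD (f g : Lp) : \forall x \ae mu, (f + g : Lp) x = f x + g x.
Proof.
have -> : f + g = piLp (repr f + repr g) by rewrite piLpD !reprK.
by apply: filterS (Lp_fun_pi (repr f + repr g)) => x /= /(_ I) ->.
Qed.

Definition scaleLp (a : scalar R k) (f : Lp) : Lp := piLp (a *: repr f).

Lemma piLpZ a (f : preLp) : piLp (a *: f) = scaleLp a (piLp f).
Proof.
apply/piLp_eq; apply: filterS (Lp_fun_pi f) => x /(_ I) fx _.
by rewrite -[LHS]/(a * f x) -[RHS]/(a * piLp f x); congr (a * _); exact/esym.
Qed.

Fact scaleLpA a b (f : Lp) : scaleLp a (scaleLp b f) = scaleLp (a * b) f.
Proof. by rewrite -[f]reprK -(piLpZ b) -(piLpZ a) -piLpZ scalerA. Qed.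

Fact scaleLp1 : left_id 1 scaleLp.
Proof. by move=> f; rewrite -[f]reprK -!piLpZ scale1r. Qed.

Fact scaleLpDr : right_distributive scaleLp +%R.
Proof.
by move=> a f g; rewrite -[f]reprK -[g]reprK -!(piLpZ a) -!piLpD -(piLpZ a) scalerDr.
Qed.

Fact scaleLpDl (f : Lp) : {morph scaleLp^~ f : a b / a + b}.
Proof. by move=> a b; rewrite -[f]reprK -!piLpZ scalerDl piLpD. Qed.

HB.instance Definition _ := GRing.Zmodule_isLmodule.Build (scalar R k) Lp
  scaleLpA scaleLp1 scaleLpDr scaleLpDl.

Lemma Lp_funZ a (f : Lp) : \forall x \ae mu, (a *: f : Lp) x = a * f x.
Proof. by apply: filterS (Lp_fun_pi (a *: repr f)) => x /= /(_ I) ->. Qed.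

Definition normLp (f : Lp) : scalar R k := ofS (fine (pnorm f)).

Lemma pnorm_fine (f : Lp) : (fine (pnorm f))%:E = pnorm f.
Proof.
rewrite fineK// fin_numElt (lt_le_trans ltNy0) ?Lnorm_ge0//=.
by case: (preLpP (repr f)).
Qed.

Lemma measurableS_Lp (f : Lp) : measurableS f.
Proof. by case: (preLpP (repr f)). Qed.

Fact ler_normLpD (f g : Lp) : normLp (f + g) <= normLp f + normLp g.
Proof.
rewrite /normLp -ofSD ler_ofS -lee_fin EFinD !pnorm_fine.
have -> : pnorm (f + g : Lp) = pnorm (repr f + repr g : preLp).
  apply: ae_eq_pnorm; first exact: measurableS_Lp.
    by case: (preLpP (repr f + repr g)).
  by apply: filterS (Lp_funD f g) => x + _.
by apply: pnormD; exact: measurableS_Lp.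
Qed.

Fact normLpZ a (f : Lp) : normLp (a *: f) = `|a| * normLp f.
Proof.
rewrite /normLp -ofS_modulus -ofSM; congr ofS.
apply: EFin_inj; rewrite EFinM !pnorm_fine -pnormZ; last exact: measurableS_Lp.
apply: ae_eq_pnorm; first exact: measurableS_Lp.
  by case: (preLpP (a *: repr f)).
by apply: filterS (Lp_funZ a f) => x + _.
Qed.

Fact normLp_eq0 (f : Lp) : normLp f = 0 -> f = 0.
Proof.
move=> n0.
have f0 : pnorm f = 0%E.
  by rewrite -pnorm_fine -[fine _](@ofSK R k) -/(normLp f) n0 reS0.
have := pnorm_eq0 (measurableS_Lp f) f0.
by rewrite -[X in _ -> X = _]reprK -piLp0 piLp_eq.
Qed.

HB.instance Definition _ := Lmodule_isNormed.Build (scalar R k) Lp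
  ler_normLpD normLpZ normLp_eq0.

Definition Lp_ge0 (f : Lp) : Prop := \forall x \ae mu, 0 <= f x.

Definition positive_op (T : Lp -> Lp) : Prop :=
  forall f : Lp, Lp_ge0 f -> Lp_ge0 (T f).

End PreLp.

Section AbsolutelyCesaroBounded.
Context {R : realType} {k : scalar_kind} {X : normedModType (scalar R k)}.
Implicit Type T : X -> X.

Definition rnorm (x : X) : R := reS `|x|.

Definition cesaro_sup (r : R) T (x : X) : \bar R :=
  ereal_sup [set (n%:R^-1 * \sum_(j < n) rnorm (iter j T x) `^ r)%:E
            | n in [set n | (1 <= n)%N]].

Definition acb_const (r : R) T (C : R) : Prop :=
  0 < C /\ forall x, (cesaro_sup r T x <= (C * rnorm x `^ r)%:E)%E.

Definition acb (r : R) T : Prop := exists C, acb_const r T C.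

(* The infimum is attained, except that it is 0 when [X] is the zero space. *)
Definition acb_min (r : R) T : R := inf [set C | acb_const r T C].

End AbsolutelyCesaroBounded.

(* Main.v *)
(* Let [f >= 0], [a_k = ||T^k f||] and [C = C_{1,ac}(T)].  For a finite set [L]
   of exponents, put [F = (sum_{j in L} (T^j f)^p)^(1/p)].  Then
   [||F||^p = sum_{j in L} a_j^p], while positivity of [T^k] gives
   [||T^k F||^p >= sum_{j in L} a_{j+k}^p].  Thus the hypothesis at [F] reads
     [sum_{k<n} (sum_{j in L} a_{j+k}^p)^(1/p) <= C n (sum_{j in L} a_j^p)^(1/p)].
   Take [L = {j < 2n : a_j <= 4 C a_0}], whose complement in [[0, 2n)] has at
   most [n/2] elements by the hypothesis at [f].  The right-hand side is then of
   order [C^2 n^(1+1/p) a_0].  On the left, put [B = sum_{n<=t<2n} a_t^p] and let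
   [nu_k] be the fraction of [B] carried by those [t] with [t - k] in [L]: every
   [t] is counted for at least half of the [k < n], and [nu_k^(1/p) >= nu_k], so
   the left-hand side is at least [B^(1/p) n / 2].  Hence [B] is at most of order
   [C^(2p) n a_0^p], and summing over dyadic blocks concludes.  A general [f]
   is a combination of four nonnegative functions of norm at most [||f||]. *)

Require Import Defs.
From mathcomp Require Import all_boot all_order all_algebra.
From mathcomp Require Import complex ring lra zify.
From mathcomp Require Import all_classical all_reals all_analysis.
From mathcomp Require Import measurable_realfun.

Import Order.TTheory GRing.Theory Num.Theory numFieldNormedType.Exports.

Local Open Scope classical_set_scope.
Local Open Scope ring_scope.

(** * Reversed and shifted finite sums *)

(** The indices [t - k] are distinct and lie in [[0, N)]; the bound [n <= t.+1] keeps the truncated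
    subtraction from collapsing several of them to [0]. *)
Lemma sum_rev_le (R : numDomainType) (a : nat -> R) n t N :
  (forall i, 0 <= a i) -> (n <= t.+1)%N -> (t < N)%N ->
  \sum_(0 <= k < n) a (t - k)%N <= \sum_(0 <= j < N) a j.
Proof.
move=> a0 nt tN.
rewrite [leRHS](big_cat_nat (n := t.+1))//= [X in _ <= X + _]big_nat_rev/= add0n.
under [X in _ <= X + _]eq_bigr do rewrite subSS.
rewrite [X in _ <= X + _](big_cat_nat (n := n))//= -addrA lerDl.
by rewrite addr_ge0// sumr_ge0.
Qed.

(** Substituting [t = j + k] moves the right-hand range to [[k, 2n + k)], which contains [[n, 2n)]
    because [k <= n]. *)
Lemma sum_shift_ge (R : numDomainType) (L : pred nat) (b : nat -> R) n k :
  (forall i, 0 <= b i) -> (k <= n)%N ->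
  \sum_(n <= t < n.*2 | L (t - k)%N) b t <=
  \sum_(0 <= j < n.*2 | L j) b (j + k)%N.
Proof.
move=> b0 kn.
have -> : \sum_(0 <= j < n.*2 | L j) b (j + k)%N =
    \sum_(k <= t < n.*2 + k | L (t - k)%N) b t.
  rewrite -{2}[k]add0n big_addn addnK; apply: eq_bigl => j.
  by rewrite addnK.
rewrite [leRHS](big_cat_nat (n := n))//=; last by lia.
rewrite [X in _ <= _ + X](big_cat_nat (n := n.*2))//=; [|lia|lia].
by rewrite addrCA lerDl addr_ge0// sumr_ge0.
Qed.

(** * Self-improvement of the averaged bound for scalar sequences *)

Section SelfImprovement.
Variables (R : realType) (p : R) (a : nat -> R) (C : R).
Hypotheses (p1 : 1 < p) (a0 : forall k, 0 <= a k) (C0 : 0 <= C).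
Hypothesis sparse_acb : forall (L : pred nat) N n,
  \sum_(0 <= k < n) (\sum_(0 <= j < N | L j) a (j + k)%N `^ p) `^ p^-1 <=
  C * n%:R * (\sum_(0 <= j < N | L j) a j `^ p) `^ p^-1.

Let p_gt0 : 0 < p. Proof. exact: lt_trans p1. Qed.
Let p_neq0 : p != 0. Proof. by rewrite gt_eqF. Qed.

Let powRpK x : 0 <= x -> (x `^ p) `^ p^-1 = x.
Proof. by move=> x0; rewrite -powRrM mulfV// powRr1. Qed.

(** With [N = 1] only the index [0] remains in the inner sums, and the roots cancel the powers. *)
Lemma acb_of_sparse n : \sum_(0 <= k < n) a k <= C * n%:R * a 0%N.
Proof.
have := sparse_acb predT 1 n.
rewrite big_nat1 powRpK// (eq_bigr a) // => k _.
by rewrite big_nat1 add0n powRpK.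
Qed.

Let L j := a j <= 4 * C * a 0%N.

(** Markov's inequality: an index outside [L] contributes at least [1] to the sum of
    [a j / (4 * C * a 0)], and over [[0, 2n)] this sum is at most [2n / 4]. The factor [4] in [L] is
    what makes this [n / 2]. *)
Lemma count_low n t : 0 < a 0%N -> 0 < C -> (n <= t < n.*2)%N ->
  n%:R / 2 <= \sum_(0 <= k < n) (L (t - k)%N)%:R :> R.
Proof.
move=> a00 C00 /andP[nt tn].
have M0 : 0 < 4 * C * a 0%N by rewrite !mulr_gt0.
have H : \sum_(0 <= k < n) (1 - (L (t - k)%N)%:R) <= n%:R / 2 :> R.
  apply: (@le_trans _ _ (\sum_(0 <= k < n) a (t - k)%N / (4 * C * a 0%N))).
    apply: ler_sum => k _; rewrite /L; case: (leP (a (t - k)%N)) => h.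
      by rewrite /= mulr1n subrr divr_ge0// ltW.
    by rewrite /= mulr0n subr0 ler_pdivlMr// mul1r ltW.
  rewrite -mulr_suml ler_pdivrMr//.
  apply: le_trans (sum_rev_le _ _ n t n.*2 a0 _ tn) _; first by lia.
  apply: le_trans (acb_of_sparse n.*2) _.
  by rewrite -mul2n natrM; lra.
move: H; rewrite sumrB sumr_const_nat subn0; lra.
Qed.

Lemma block_le n : 0 < a 0%N -> 0 < C ->
  \sum_(n <= t < n.*2) a t `^ p <=
  2 * 8 `^ p * C `^ (2 * p) * n%:R * a 0%N `^ p.
Proof.
move=> a00 C00.
case: n => [|n0]; first by rewrite big_geq// mulr0 mul0r.
set n := n0.+1.
have n_gt0 : 0 < n%:R :> R by rewrite ltr0n.
set B := \sum_(_ <= _ < _) _.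
have B0 : 0 <= B by apply: sumr_ge0 => i _; rewrite powR_ge0.
move: B0; rewrite le_eqVlt => /predU1P[<-|B0].
  by rewrite !mulr_ge0// ?powR_ge0.
pose g k := \sum_(n <= t < n.*2 | L (t - k)%N) a t `^ p.
have g0 k : 0 <= g k by apply: sumr_ge0 => i _; rewrite powR_ge0.
have gB k : g k <= B.
  rewrite /g /B big_mkcond/=; apply: ler_sum => i _.
  by case: ifP => //; rewrite powR_ge0.
have pV1 : p^-1 <= 1 by rewrite invf_le1// ltW.
(* [g k / B <= 1], so raising to the power [1/p] increases it *)
have gpow k : B `^ p^-1 * (g k / B) <= g k `^ p^-1.
  have [->|gk] := eqVneq (g k) 0; first by rewrite mul0r mulr0 powR_ge0.
  rewrite -{2}[g k](divfK (lt0r_neq0 B0)).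
  rewrite (powRM _ (divr_ge0 (g0 k) (ltW B0)) (ltW B0)) mulrC.
  rewrite ler_wpM2r ?powR_ge0//.
  have rk : 0 < g k / B by rewrite divr_gt0// lt0r gk g0.
  by rewrite ger1_powR// rk ler_pdivrMr// mul1r gB.
have sumg : n%:R / 2 * B <= \sum_(0 <= k < n) g k.
  rewrite /g; under eq_bigr do rewrite big_mkcond/=.
  rewrite exchange_big_nat/= /B mulr_sumr [leLHS]big_nat [leRHS]big_nat.
  apply: ler_sum => t tn.
  apply: le_trans (_ : (\sum_(0 <= k < n) (L (t - k)%N)%:R) * a t `^ p <= _).
    by rewrite ler_wpM2r ?powR_ge0// count_low.
  rewrite mulr_suml ler_sum// => k _.
  by case: ifP; rewrite ?mul1r ?mul0r.
have lower : B `^ p^-1 * (n%:R / 2) <=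
    \sum_(0 <= k < n) (\sum_(0 <= j < n.*2 | L j) a (j + k)%N `^ p) `^ p^-1.
  apply: (@le_trans _ _ (\sum_(0 <= k < n) g k `^ p^-1)).
    apply: le_trans (_ : \sum_(0 <= k < n) B `^ p^-1 * (g k / B) <= _).
      by rewrite -mulr_sumr -mulr_suml ler_wpM2l ?powR_ge0// ler_pdivlMr.
    by apply: ler_sum => k _; exact: gpow.
  rewrite [leLHS]big_nat [leRHS]big_nat; apply: ler_sum => k /andP[_ kn].
  apply: ge0_ler_powR; rewrite ?invr_ge0 ?(ltW p_gt0)// ?nnegrE//.
    by apply: sumr_ge0 => i _; rewrite powR_ge0.
  by apply: (sum_shift_ge _ L (fun t => a t `^ p)); [move=> i; exact: powR_ge0|exact: ltnW].
have upper : (\sum_(0 <= j < n.*2 | L j) a j `^ p) `^ p^-1 <=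
    (2 * n%:R) `^ p^-1 * (4 * C * a 0%N).
  rewrite -[X in _ * X]powRpK; last by rewrite !mulr_ge0.
  rewrite -powRM ?mulr_ge0 ?powR_ge0//.
  apply: ge0_ler_powR; rewrite ?invr_ge0 ?(ltW p_gt0)// ?nnegrE//.
  - by apply: sumr_ge0 => i _; rewrite powR_ge0.
  - by rewrite !mulr_ge0// powR_ge0.
  rewrite big_mkcond/=.
  apply: le_trans (_ : \sum_(0 <= j < n.*2) (4 * C * a 0%N) `^ p <= _).
    apply: ler_sum => j _; rewrite /L; case: ifP => h; rewrite ?powR_ge0//.
    by apply: ge0_ler_powR; rewrite ?(ltW p_gt0)// ?nnegrE// !mulr_ge0.
  by rewrite sumr_const_nat subn0 -mul2n -[X in X <= _]mulr_natl natrM.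
(* Chaining [lower], the hypothesis and [upper] gives [B^(1/p) * n / 2 <= C * n * (2n)^(1/p) * 4 * C
   * a 0]; cancel [n]. The [p]-th power of this is the claim, with [(2n)^(1/p)] supplying the factor
   [2n]. *)
have root_le : B `^ p^-1 <= 8 * C ^+ 2 * (2 * n%:R) `^ p^-1 * a 0%N.
  have := le_trans lower (sparse_acb L n.*2 n).
  move=> /le_trans /(_ (ler_wpM2l _ upper)) => /(_ (mulr_ge0 C0 (ltW n_gt0))).
  move=> h; rewrite -(ler_pM2r n_gt0); move: h; set r := (2 * _) `^ _; lra.
have rootK x : 0 <= x -> (x `^ p^-1) `^ p = x.
  by move=> x0; rewrite -powRrM mulVf// powRr1.
rewrite -(rootK B (ltW B0)).
apply: le_trans (ge0_ler_powR _ _ _ root_le) _; rewrite ?(ltW p_gt0)// ?nnegrE ?powR_ge0//.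
  by rewrite !mulr_ge0// ?powR_ge0 ?exprn_ge0.
rewrite !powRM ?mulr_ge0 ?powR_ge0 ?exprn_ge0 ?ler0n//.
rewrite !rootK// (_ : C `^ (2 * p) = C `^ p * C `^ p); first lra.
by rewrite mulrC powRrM (powR_mulrn 2) ?powR_ge0// expr2.
Qed.

Lemma sum_powR_le_of_sparse n :
  \sum_(0 <= k < n) a k `^ p <=
  6 * 8 `^ p * C `^ (2 * p) * n%:R * a 0%N `^ p.
Proof.
have K0 : 0 <= 8 `^ p * C `^ (2 * p) * a 0%N `^ p by rewrite !mulr_ge0 ?powR_ge0.
(* If [a 0 = 0], the averaged bound forces every term to vanish; otherwise the threshold
   [4 * C * a 0] can be used as a divisor. *)
have := a0 0%N; rewrite le_eqVlt => /predU1P[a00|a00].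
  rewrite big_nat big1 ?mulr_ge0 ?powR_ge0// => k /andP[_ kn].
  have ak : a k <= 0.
    have := acb_of_sparse k.+1; rewrite -a00 mulr0; apply: le_trans.
    by rewrite big_nat_recr//= lerDr sumr_ge0.
  by rewrite (_ : a k = 0) ?powR0//; apply/le_anti; rewrite ak a0.
(* The averaged bound at [n = 1] reads [a 0 <= C * a 0]. Hence [8^p * C^(2p) >= 1], which settles
   the base case [n = 1] of the induction. *)
have C1 : 1 <= C.
  by have := acb_of_sparse 1; rewrite big_nat1 mulr1 ler_pMl.
have C00 : 0 < C by exact: lt_le_trans C1.
have ge1_powR (x r : R) : 1 <= x -> 0 <= r -> 1 <= x `^ r.
  by move=> x1 r0; rewrite -[leLHS](powRr0 x) ler_powR.
have K1 : a 0%N `^ p <= 8 `^ p * C `^ (2 * p) * a 0%N `^ p.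
  rewrite ler_peMl ?powR_ge0// mulr_ege1// ge1_powR ?mulr_ge0 ?(ltW p_gt0)//.
  by rewrite ler1n.
elim/ltn_ind: n => -[|[|n]] IH; first by rewrite big_geq// mulr0 mul0r.
  by rewrite big_nat1; lra.
(* Split at half the length, rounded up, so that the upper part fits in the block [[h, 2h)]. The
   induction hypothesis and the block bound add up to [(6 + 2) * h] units, and [8 * h <= 6 * m]
   holds for every length [m >= 2], though not for [m = 1]: hence the constant [6] and the separate
   base case. *)
pose h := uphalf n.+2.
have hn : (h < n.+2)%N by rewrite /h; lia.
rewrite (big_cat_nat (n := h))//=; last exact: ltnW.
have H2 : \sum_(h <= k < n.+2) a k `^ p <= \sum_(h <= k < h.*2) a k `^ p.
  rewrite [leRHS](big_cat_nat (n := n.+2))//=; [|exact: ltnW|by rewrite /h; lia].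
  by rewrite lerDl sumr_ge0// => i _; rewrite powR_ge0.
have H3 := block_le h a00 C00.
have H4 := IH _ hn.
have H5 : 4 * h%:R <= 3 * n.+2%:R :> R.
  by rewrite -!natrM ler_nat /h; lia.
have H6 := ler_wpM2l K0 H5.
move: H2 H3 H4 H6; set X := 8 `^ p; set Y := C `^ _; set Z := a 0%N `^ p.
lra.
Qed.
End SelfImprovement.

(** * Duality for the two-term l^p norm, with rational coefficients *)

Lemma rat_approx_below (R : realType) (x e : R) : 0 <= x -> 0 < e ->
  exists r : rat, [/\ 0 <= ratr r :> R, ratr r <= x & x - e <= ratr r].
Proof.
move=> x0 e0; have [xe|ex] := leP x e.
  by exists 0; rewrite rmorph0 lexx subr_le0.
have /rat_in_itvoo[r /itvP rx] : x - e < x by rewrite gtrBl.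
by exists r; rewrite !(ltW (_ : _ < _)) ?rx// (@lt_trans _ _ (x - e)) ?rx// subr_gt0.
Qed.

(** Converse of Hölder's inequality. Testing only rational coefficients lets the hypothesis be
    verified almost everywhere, at the cost of countably many null sets. *)
Lemma powR_sum2_le_dual (R : realType) (p q u v w : R) :
  0 < p -> 0 < q -> p^-1 + q^-1 = 1 -> 0 <= u -> 0 <= v -> 0 <= w ->
  (forall r s : rat, 0 <= ratr r :> R -> 0 <= ratr s :> R ->
    ratr r * u + ratr s * v <=
    (ratr r `^ q + ratr s `^ q) `^ q^-1 * w) ->
  u `^ p + v `^ p <= w `^ p.
Proof.
move=> p0 q0 pq u0 v0 w0 H.
have p1 : 1 < p by rewrite -invf_lt1// -pq ltrDl invr_gt0.
set S := u `^ p + v `^ p.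
have S0 : 0 <= S by rewrite addr_ge0 ?powR_ge0.
have pqE : (p - 1) * q = p.
  have : (p^-1 + q^-1) * (p * q) = p * q by rewrite pq mul1r.
  rewrite mulrDl mulrA mulVf ?gt_eqF// mul1r mulrCA mulVf ?gt_eqF// mulr1; lra.
have HR (x y : R) : 0 <= x -> 0 <= y ->
    x * u + y * v <= (x `^ q + y `^ q) `^ q^-1 * w.
  (* Rounding [x] and [y] down by at most [e / (u + v + 1)] lowers the left side by at most [e] and
     does not increase the right side; the [+ 1] keeps the denominator positive. *)
  move=> x0 y0; apply/ler_addgt0Pr => e e0.
  have uv0 : 0 < u + v + 1 by rewrite ltr_wpDl ?addr_ge0.
  have d0 : 0 < e / (u + v + 1) by rewrite divr_gt0.
  have [r [r0 rx xr]] := rat_approx_below _ _ _ x0 d0.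
  have [s [s0 sy ys]] := rat_approx_below _ _ _ y0 d0.
  have dE : e / (u + v + 1) * (u + v) <= e.
    by rewrite mulrAC ler_pdivrMr// ler_pM2l// lerDl.
  have l1 := ler_wpM2r u0 xr.
  have l2 := ler_wpM2r v0 ys.
  have l3 : (ratr r `^ q + ratr s `^ q) `^ q^-1 * w <=
            (x `^ q + y `^ q) `^ q^-1 * w.
    apply: (ler_wpM2r w0).
    have mono := ge0_ler_powR (ltW q0).
    apply: ge0_ler_powR; rewrite ?nnegrE ?addr_ge0 ?powR_ge0 ?invr_ge0 ?(ltW q0)//.
    by rewrite lerD// mono.
  have := H _ _ r0 s0; move=> l4.
  have {}l3 := le_trans l4 l3.
  move: l1 l2 l3 dE {l4}; rewrite !mulrBl mulrDr.
  move: (e / _) (_ `^ q^-1 * w) (ratr r) (ratr s) => t W r' s'; lra.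
have [->|Sn0] := eqVneq S 0; first exact: powR_ge0.
have Sgt : 0 < S by rewrite lt0r Sn0.
(* These are the extremal coefficients in Hölder's inequality: since [(p - 1) * q = p], the bound
   becomes [S <= S^(1/q) * w], and dividing by [S^(1/q)] leaves [S^(1/p) <= w]. *)
have := HR (u `^ (p - 1)) (v `^ (p - 1)) (powR_ge0 _ _) (powR_ge0 _ _).
rewrite -!powRrM pqE ![_ `^ _ * _]mulrC !mulr_powRB1// -/S mulrC => SS.
have : S `^ p^-1 <= w.
  rewrite -(ler_pM2l (powR_gt0 q^-1 Sgt)); apply: le_trans SS.
  by rewrite -powRD ?Sn0 ?implybT// addrC pq powRr1.
move=> /(ge0_ler_powR (ltW p0)); rewrite !nnegrE powR_ge0 w0 => /(_ isT isT).
by rewrite -powRrM mulVf ?gt_eqF// powRr1.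
Qed.

(** * Real and complex scalars: nonnegativity and moduli *)

Section Scalars.
Context {R : realType} {k : scalar_kind}.
Implicit Types (z w : Defs.scalar R k) (a : R).

Lemma imS_ofS a : imS (ofS a : Defs.scalar R k) = 0. Proof. by case: k. Qed.

Lemma scalar_ge0P z : 0 <= z -> z = ofS (modulus z).
Proof. by move=> z0; rewrite ofS_modulus ger0_norm. Qed.

Lemma modulus_ofS a : 0 <= a -> modulus (ofS a : Defs.scalar R k) = a.
Proof.
by move=> a0; rewrite /modulus ger0_norm ?ofSK// -(@ofS0 R k) ler_ofS.
Qed.

Lemma ofS_ge0 a : (0 <= ofS a :> Defs.scalar R k) = (0 <= a).
Proof. by rewrite -[X in X <= _](@ofS0 R k) ler_ofS. Qed.

Lemma normr_reS_le z : `|reS z| <= modulus z.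
Proof. by rewrite modulusE -sqrtr_sqr ler_wsqrtr// lerDl sqr_ge0. Qed.

Lemma normr_imS_le z : `|imS z| <= modulus z.
Proof. by rewrite modulusE -sqrtr_sqr ler_wsqrtr// lerDr sqr_ge0. Qed.
End Scalars.

(** * Positive operators and l^p combinations in L^p *)

(** Linearity as a property of a bare function, so that it can be stated for the iterates of an
    operator. *)
Local Notation linop S := (forall a f g, S (a *: f + g) = a *: S f + S g).

Section Positive.
Context {R : realType} {k : scalar_kind} {d : measure_display}
  {Omega : measurableType d} {mu : {measure set Omega -> \bar R}} {p : R}.
Hypothesis p1 : 1 < p.
Local Notation Lp := (Lp k mu (ltW p1)).
Implicit Types f g h : Lp.

Let p_gt0 : 0 < p. Proof. exact: lt_trans p1. Qed.
Let p_neq0 : p != 0. Proof. by rewrite gt_eqF. Qed.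

Lemma rnormE f : rnorm f = fine (pnorm mu p f).
Proof. by rewrite /rnorm /= ofSK. Qed.

Lemma rnorm_ge0 f : 0 <= rnorm f.
Proof. by rewrite rnormE fine_ge0// Lnorm_ge0. Qed.

Lemma rnormD f g : rnorm (f + g) <= rnorm f + rnorm g.
Proof.
by rewrite !rnormE -(@ler_ofS R k) ofSD; exact: ler_normLpD.
Qed.

Lemma rnormZ (a : Defs.scalar R k) f : rnorm (a *: f) = modulus a * rnorm f.
Proof.
have := normLpZ a f; rewrite /normLp -ofS_modulus -ofSM => /(can_inj ofSK).
by rewrite !rnormE.
Qed.

Lemma rnorm_powR f :
  (rnorm f `^ p)%:E = (\int[mu]_x (modulus (f x) `^ p)%:E)%E.
Proof.
rewrite rnormE -poweR_EFin pnorm_fine pnormE -poweRrM mulVf//.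
by rewrite poweRe1// integral_ge0// => x _; rewrite lee_fin powR_ge0.
Qed.

Lemma Lp_of_fun (phi : Omega -> R) :
  measurable_fun setT phi -> (forall x, 0 <= phi x) ->
  (\int[mu]_x (phi x `^ p)%:E < +oo)%E ->
  exists g : Lp, Lp_ge0 g /\ \forall x \ae mu, g x = ofS (phi x).
Proof.
move=> mphi phi0 phioo.
pose F x : Defs.scalar R k := ofS (phi x).
have mF : measurableS F.
  split; first by under eq_fun do rewrite ofSK.
  by under eq_fun do rewrite imS_ofS; exact: measurable_cst.
have Fin : F \in preLp_pred mu (ltW p1).
  rewrite inE; split=> //; rewrite pnormE.
  apply: poweR_lty; under eq_integral do rewrite modulus_ofS//.
  by [].
exists (\pi_(Defs.Lp k mu (ltW p1))%qT (PreLp Fin)).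
have E := Lp_fun_pi (PreLp Fin).
split; apply: filterS E => x /= /(_ I) -> //.
by rewrite ofS_ge0.
Qed.


Lemma linop0 (S : Lp -> Lp) : linop S -> S 0 = 0.
Proof. by move=> /(_ (-1) 0 0); rewrite scaler0 addr0 scaleN1r addNr. Qed.

Lemma linopZ (S : Lp -> Lp) a f : linop S -> S (a *: f) = a *: S f.
Proof. by move=> SP; rewrite -[a *: f]addr0 SP linop0// addr0. Qed.

Lemma Lp_fun_comb2 a b f g :
  \forall x \ae mu, (a *: f + b *: g : Lp) x = a * f x + b * g x.
Proof.
apply: filterS3 (Lp_funD (a *: f) (b *: g)) (Lp_funZ a f) (Lp_funZ b g).
by move=> x -> -> ->.
Qed.

Lemma Lp_fun_comb3 a b c f g h :
  \forall x \ae mu, (a *: f + (b *: g + c *: h) : Lp) x =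
    a * f x + (b * g x + c * h x).
Proof.
apply: filterS3 (Lp_funD (a *: f) (b *: g + c *: h))
  (Lp_funZ a f) (Lp_fun_comb2 b c g h).
by move=> x -> -> ->.
Qed.

(** Encodes a pointwise linear inequality as nonnegativity of a single element of L^p, the form that
    a positive operator preserves. Nonnegative functions agree almost everywhere with their
    moduli. *)
Lemma Lp_ge0_comb3 (r s c : R) f g h : Lp_ge0 f -> Lp_ge0 g -> Lp_ge0 h ->
  Lp_ge0 (ofS (- r) *: f + (ofS (- s) *: g + ofS c *: h) : Lp) <->
  \forall x \ae mu,
    r * modulus (f x) + s * modulus (g x) <= c * modulus (h x).
Proof.
move=> f0 g0 h0.
have E : \forall x \ae mu,
    (ofS (- r) *: f + (ofS (- s) *: g + ofS c *: h) : Lp) x =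
    ofS (c * modulus (h x) - (r * modulus (f x) + s * modulus (g x))).
  near=> x.
  have -> : (ofS (- r) *: f + (ofS (- s) *: g + ofS c *: h) : Lp) x =
      ofS (- r) * f x + (ofS (- s) * g x + ofS c * h x).
    by near: x; exact: Lp_fun_comb3.
  have fx : f x = ofS (modulus (f x)) by apply: scalar_ge0P; near: x.
  have gx : g x = ofS (modulus (g x)) by apply: scalar_ge0P; near: x.
  have hx : h x = ofS (modulus (h x)) by apply: scalar_ge0P; near: x.
  rewrite {1}fx {1}gx {1}hx.
  by rewrite -!ofSM -!ofSD; congr ofS; ring.
split=> H; apply: filterS2 E H => x ->; by rewrite ofS_ge0 subr_ge0.
Unshelve. all: by end_near. Qed.

Lemma measurable_normp f : measurable_fun setT (fun x => (modulus (f x) `^ p)%:E).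
Proof. exact: measurable_modulus_powR (measurableS_Lp f). Qed.

Lemma rnorm_powRD f g :
  (rnorm f `^ p + rnorm g `^ p)%:E =
  (\int[mu]_x (modulus (f x) `^ p + modulus (g x) `^ p)%:E)%E.
Proof.
rewrite EFinD !rnorm_powR -ge0_integralD//; try exact: measurable_normp.
- by move=> x _; rewrite lee_fin powR_ge0.
- by move=> x _; rewrite lee_fin powR_ge0.
Qed.

(* [h] is the pointwise l^p combination of [f] and [g]; since a positive
   operator preserves the inequalities [r f + s g <= c h] that describe it by
   duality, it can only increase it. *)
Lemma exists_lp_join f g : Lp_ge0 f -> Lp_ge0 g ->
  exists h, [/\ Lp_ge0 h, rnorm h `^ p = rnorm f `^ p + rnorm g `^ p &
    forall S : Lp -> Lp, linop S -> positive_op S ->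
      rnorm (S f) `^ p + rnorm (S g) `^ p <= rnorm (S h) `^ p].
Proof.
move=> f0 g0.
pose phi x := (modulus (f x) `^ p + modulus (g x) `^ p) `^ p^-1.
have phip x : phi x `^ p = modulus (f x) `^ p + modulus (g x) `^ p.
  by rewrite /phi -powRrM mulVf// powRr1// addr_ge0 ?powR_ge0.
have iphi : (\int[mu]_x (phi x `^ p)%:E = (rnorm f `^ p + rnorm g `^ p)%:E)%E.
  by rewrite rnorm_powRD; apply: eq_integral => x _; rewrite phip.
have [||h [h0 hE]] := @Lp_of_fun phi _ (fun x => powR_ge0 _ _).
- apply: (measurableT_comp (measurable_powR _)).
  by apply: measurable_funD; apply/measurable_EFinP; exact: measurable_normp.
- by rewrite iphi ltry.
exists h; split=> //.
  apply: EFin_inj; rewrite rnorm_powR -iphi; apply: ge0_ae_eq_integral => //.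
  - exact: measurable_normp.
  - under eq_fun do rewrite phip EFinD.
    by apply: emeasurable_funD; exact: measurable_normp.
  - by move=> x _; rewrite lee_fin powR_ge0.
  - by move=> x _; rewrite lee_fin powR_ge0.
  by apply: filterS hE => x -> _; rewrite modulus_ofS ?powR_ge0.
move=> S SP S0.
pose q := p / (p - 1).
have pB0 : 0 < p - 1 by rewrite subr_gt0.
have q0 : 0 < q by rewrite divr_gt0.
have pq : p^-1 + q^-1 = 1 by rewrite /q invf_div; field.
have Sf0 := S0 _ f0; have Sg0 := S0 _ g0; have Sh0 := S0 _ h0.
(* Hölder's inequality for two terms gives the inequality for [f], [g] and [h]; linearity and
   positivity transport it through [S]. *)
have dual (r s : rat) : 0 <= ratr r :> R -> 0 <= ratr s :> R ->
    \forall x \ae mu, ratr r * modulus (S f x) + ratr s * modulus (S g x) <=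
      (ratr r `^ q + ratr s `^ q) `^ q^-1 * modulus (S h x).
  move=> r0 s0; apply/Lp_ge0_comb3 => //.
  rewrite -(linopZ S _ h SP) -!SP; apply: S0; apply/Lp_ge0_comb3 => //.
  apply: filterS hE => x ->; rewrite modulus_ofS ?powR_ge0//.
  by apply: hoelder2; rewrite ?modulus_ge0// addrC.
(* Pairs of rationals are enumerated by their codes, so the exceptional null sets form a countable
   family and one null set serves all pairs. Codes of no pair carry the condition [True]. *)
have dualA : \forall x \ae mu, forall n,
    if (unpickle n : option (rat * rat)) is Some rs then
      0 <= ratr rs.1 :> R -> 0 <= ratr rs.2 :> R ->
      ratr rs.1 * modulus (S f x) + ratr rs.2 * modulus (S g x) <=
      (ratr rs.1 `^ q + ratr rs.2 `^ q) `^ q^-1 * modulus (S h x)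
    else True.
  apply: ae_foralln => n; case: unpickle => [[r s]|]; last exact: aeW.
  have [r0|/negP r0] := boolP (0 <= ratr r :> R); last exact: aeW.
  have [s0|/negP s0] := boolP (0 <= ratr s :> R); last exact: aeW.
  by apply: filterS (dual r s r0 s0).
rewrite -lee_fin rnorm_powRD rnorm_powR; apply: ae_ge0_le_integral => //.
- by move=> x _; rewrite lee_fin addr_ge0 ?powR_ge0.
- by under eq_fun do rewrite EFinD; apply: emeasurable_funD; exact: measurable_normp.
- by move=> x _; rewrite lee_fin powR_ge0.
- exact: measurable_normp.
apply: filterS dualA => x H _; rewrite lee_fin.
apply: (@powR_sum2_le_dual _ _ q); rewrite ?modulus_ge0// => r s.
by have := H (pickle (r, s)); rewrite pickleK.
Qed.

Lemma Lp_ge0_0 : Lp_ge0 (0 : Lp).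
Proof.
by rewrite -(scale0r (0 : Lp)); apply: filterS (Lp_funZ 0 (0 : Lp)) => x ->; rewrite mul0r.
Qed.

(** Iterates the two-term join, starting from [0]. The same [h] works for every [S], so that later
    one function can be tested against all powers of [T]. *)
Lemma exists_lp_sum (g : nat -> Lp) (L : pred nat) N : (forall j, Lp_ge0 (g j)) ->
  exists h, [/\ Lp_ge0 h,
    rnorm h `^ p = \sum_(0 <= j < N | L j) rnorm (g j) `^ p &
    forall S : Lp -> Lp, linop S -> positive_op S ->
      \sum_(0 <= j < N | L j) rnorm (S (g j)) `^ p <= rnorm (S h) `^ p].
Proof.
move=> g0; elim: N => [|N [h [h0 hN hS]]].
  exists 0; split=> [| |S _ _]; first exact: Lp_ge0_0.
    by rewrite big_geq// -(scale0r 0) rnormZ modulus0 mul0r powR0.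
  by rewrite big_geq// powR_ge0.
have [LN|LN] := boolP (L N); last first.
  exists h; split=> // [|S SP S0]; rewrite big_mkcond big_nat_recr//= -big_mkcond/=.
    by rewrite (negbTE LN) addr0.
  by rewrite (negbTE LN) addr0 hS.
have [h' [h'0 h'N h'S]] := exists_lp_join _ _ h0 (g0 N).
exists h'; split=> // [|S SP S0]; rewrite big_mkcond big_nat_recr//= -big_mkcond/=.
  by rewrite LN h'N hN.
by rewrite LN; apply: le_trans (h'S S SP S0); rewrite lerD2r hS.
Qed.
End Positive.

(** * From the averaged bound to the bound on [p]-th powers *)

Section CesaroPower.
Context {R : realType} {k : scalar_kind} {d : measure_display}
  {Omega : measurableType d} {mu : {measure set Omega -> \bar R}} {p : R}.
Hypothesis p1 : 1 < p.
Local Notation Lp := (Lp k mu (ltW p1)).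
Variable T : Lp -> Lp.
Hypotheses (Tlin : linop T) (Tpos : positive_op T).

Let p_gt0 : 0 < p. Proof. exact: lt_trans p1. Qed.
Let p_neq0 : p != 0. Proof. by rewrite gt_eqF. Qed.

Lemma iter_linop n : linop (iter n T).
Proof. by elim: n => // n IH a f g; rewrite !iterS IH Tlin. Qed.

Lemma iter_positive n : positive_op (iter n T).
Proof. by elim: n => // n IH f f0; rewrite iterS; exact/Tpos/IH. Qed.

Section Bound.
Variable C : R.
Hypothesis C0 : 0 <= C.
Hypothesis Tacb : forall n f,
  \sum_(0 <= j < n) rnorm (iter j T f) <= C * n%:R * rnorm f.

(** Apply the averaged bound to the l^p combination [h] of the functions [T^i f] with [i] in [L]:
    its norm is the root on the right, and the norm of [T^j h] dominates the [j]-th root on the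
    left. *)
Lemma sparse_acb_positive f (L : pred nat) N n : Lp_ge0 f ->
  \sum_(0 <= j < n) (\sum_(0 <= i < N | L i) rnorm (iter (i + j) T f) `^ p) `^ p^-1 <=
  C * n%:R * (\sum_(0 <= i < N | L i) rnorm (iter i T f) `^ p) `^ p^-1.
Proof.
move=> f0.
have [h [h0 hN hT]] :=
  exists_lp_sum p1 _ L N (fun j => iter_positive j f f0).
have rK (g : Lp) : (rnorm g `^ p) `^ p^-1 = rnorm g.
  by rewrite -powRrM mulfV// powRr1// rnorm_ge0.
rewrite -hN rK; apply: le_trans (Tacb n h).
apply: ler_sum => j _; rewrite -(rK (iter j T h)).
have pV0 : 0 <= p^-1 by rewrite invr_ge0 ltW.
apply: (ge0_ler_powR pV0); rewrite ?nnegrE ?powR_ge0//.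
  by apply: sumr_ge0 => i _; rewrite powR_ge0.
have := hT _ (iter_linop j) (iter_positive j); apply: le_trans.
by apply: ler_sum => i _; rewrite addnC iterD.
Qed.

Lemma acb_powR_positive n f : Lp_ge0 f ->
  \sum_(0 <= j < n) rnorm (iter j T f) `^ p <=
  6 * 8 `^ p * C `^ (2 * p) * n%:R * rnorm f `^ p.
Proof.
move=> f0.
apply: (sum_powR_le_of_sparse _ _ (fun j => rnorm (iter j T f)) _ p1 _ C0).
  by move=> j; exact: rnorm_ge0.
by move=> L N m; exact: sparse_acb_positive.
Qed.
End Bound.

Lemma powRD_le (x y : R) : 0 <= x -> 0 <= y ->
  (x + y) `^ p <= 2 `^ p * (x `^ p + y `^ p).
Proof.
wlog xy : x y / x <= y => [H x0 y0|x0 y0].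
  have [xy|/ltW yx] := leP x y; first exact: H.
  by rewrite addrC [X in _ * X]addrC; exact: H.
have H : x + y <= 2 * y by lra.
have {}H := ge0_ler_powR (ltW p_gt0) _ _ H.
apply: le_trans (H _ _) _; rewrite ?nnegrE ?addr_ge0 ?mulr_ge0//.
by rewrite powRM// ler_wpM2l ?powR_ge0// lerDr powR_ge0.
Qed.

(** Serves both to recombine positive with negative parts and real with imaginary parts; each use
    costs a factor [2^p * 2]. *)
Lemma acb_powR_comb (a b : Defs.scalar R k) (f g : Lp) M n :
  modulus a <= 1 -> modulus b <= 1 ->
  \sum_(0 <= j < n) rnorm (iter j T f) `^ p <= M ->
  \sum_(0 <= j < n) rnorm (iter j T g) `^ p <= M ->
  \sum_(0 <= j < n) rnorm (iter j T (a *: f + b *: g)) `^ p <= 2 `^ p * 2 * M.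
Proof.
move=> a1 b1 fM gM.
apply: (@le_trans _ _ (\sum_(0 <= j < n)
    2 `^ p * (rnorm (iter j T f) `^ p + rnorm (iter j T g) `^ p))).
  apply: ler_sum => j _; apply: le_trans (powRD_le _ _ _ _); rewrite ?rnorm_ge0//.
  rewrite iter_linop (linopZ _ (iter j T) b g (iter_linop j)).
  apply: (ge0_ler_powR (ltW p_gt0)); rewrite ?nnegrE ?addr_ge0 ?rnorm_ge0//.
  by apply: le_trans (rnormD _ _ _) _; rewrite !rnormZ lerD// ler_piMl ?rnorm_ge0.
rewrite -mulr_sumr big_split/= -mulrA ler_wpM2l ?powR_ge0//; lra.
Qed.

Lemma Lp_part (phi : Omega -> R) (f : Lp) : measurable_fun setT phi ->
  (forall x, 0 <= phi x <= modulus (f x)) ->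
  exists g : Lp, [/\ Lp_ge0 g, rnorm g `^ p <= rnorm f `^ p &
    \forall x \ae mu, g x = ofS (phi x)].
Proof.
move=> mphi phif.
have phi0 x : 0 <= phi x by case/andP: (phif x).
have mp : measurable_fun setT (fun x => (phi x `^ p)%:E).
  by apply/measurable_EFinP; exact: (measurableT_comp (measurable_powR _)).
have le : (\int[mu]_x (phi x `^ p)%:E <= (rnorm f `^ p)%:E)%E.
  rewrite rnorm_powR; apply: ge0_le_integral => //.
  - by move=> x _; rewrite lee_fin powR_ge0.
  - exact: measurable_normp.
  move=> x _; rewrite lee_fin; case/andP: (phif x) => ? ?.
  by apply: (ge0_ler_powR (ltW p_gt0)); rewrite ?nnegrE ?modulus_ge0.
have [g [g0 gE]] := @Lp_of_fun R k d Omega mu p p1 phi mphi phi0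
  (le_lt_trans le (ltry _)).
exists g; split => //; rewrite -lee_fin; apply: le_trans le.
rewrite rnorm_powR le_eqVlt; apply/orP; left; apply/eqP.
apply: ge0_ae_eq_integral => //.
- exact: measurable_normp.
- by move=> x _; rewrite lee_fin powR_ge0.
- by move=> x _; rewrite lee_fin powR_ge0.
by apply: filterS gE => x -> _; rewrite modulus_ofS.
Qed.

(** The parts [max(phi, 0)] and [max(-phi, 0)] are both dominated by the modulus of [f]. Explicit
    coefficients [1] and [-1] give the difference the shape required by [acb_powR_comb]. *)
Lemma Lp_posneg (phi : Omega -> R) (f : Lp) : measurable_fun setT phi ->
  (forall x, `|phi x| <= modulus (f x)) ->
  exists g h : Lp, [/\ Lp_ge0 g /\ Lp_ge0 h,
    rnorm g `^ p <= rnorm f `^ p, rnorm h `^ p <= rnorm f `^ p &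
    \forall x \ae mu, (1 *: g + (-1) *: h : Lp) x = ofS (phi x)].
Proof.
move=> mphi phif.
have [||g [g0 gf gE]] := Lp_part (fun x => Num.max (phi x) 0) f.
- exact: measurable_maxr.
- move=> x; rewrite le_max lexx orbT ge_max modulus_ge0 andbT.
  exact: le_trans (ler_norm _) (phif x).
have [||h [h0 hf hE]] := Lp_part (fun x => Num.max (- phi x) 0) f.
- by apply: measurable_maxr => //; exact: measurableT_comp.
- move=> x; rewrite le_max lexx orbT ge_max modulus_ge0 andbT.
  by apply: le_trans (phif x); rewrite -normrN ler_norm.
exists g, h; split => //.
apply: filterS3 (Lp_fun_comb2 p1 1 (-1) g h) gE hE => x -> -> ->.
rewrite mul1r mulN1r; apply/eqP; rewrite subr_eq -ofSD; apply/eqP; congr ofS.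
case: (leP (phi x) 0) => h1; case: (leP (- phi x) 0); lra.
Qed.

(** Over the reals the imaginary part vanishes, so the value [0] makes one decomposition formula
    valid for both kinds of scalars. *)
Definition imag_unit : Defs.scalar R k :=
  match k with RealScalars => 0 | ComplexScalars => Complex 0 1 end.

Lemma modulus_imag_unit : modulus imag_unit <= 1.
Proof.
rewrite modulusE /imag_unit; case: k => /=.
  by rewrite expr0n addr0 sqrtr0.
by rewrite expr0n expr1n add0r sqrtr1.
Qed.

Lemma scalar_reim (z : Defs.scalar R k) :
  z = 1 * ofS (reS z) + imag_unit * ofS (imS z).
Proof.
rewrite /imag_unit mul1r; case: k z => [z|[x y]] /=.
  by rewrite mul0r addr0.
by congr Complex; rewrite /=; ring.
Qed.

Lemma Lp_decomposition (f : Lp) : exists g1 g2 g3 g4 : Lp,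
  [/\ forall g, g \in [:: g1; g2; g3; g4] ->
        Lp_ge0 g /\ rnorm g `^ p <= rnorm f `^ p &
      f = 1 *: (1 *: g1 + (-1) *: g2) + imag_unit *: (1 *: g3 + (-1) *: g4)].
Proof.
have [mr mi] := measurableS_Lp f.
have [g1 [g2 [[p1' p2] l1 l2 E1]]] := Lp_posneg _ f mr (fun x => normr_reS_le _).
have [g3 [g4 [[p3 p4] l3 l4 E2]]] := Lp_posneg _ f mi (fun x => normr_imS_le _).
exists g1, g2, g3, g4; split.
  by move=> g; rewrite !inE => /or4P[] /eqP ->.
apply/LpP; apply: filterS3 (Lp_fun_comb2 p1 1 imag_unit
  (1 *: g1 + (-1) *: g2) (1 *: g3 + (-1) *: g4)) E1 E2.
by move=> x -> -> -> _; exact: scalar_reim.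
Qed.

Lemma acb_powR C n f : 0 <= C ->
  (forall n f, \sum_(0 <= j < n) rnorm (iter j T f) <= C * n%:R * rnorm f) ->
  \sum_(0 <= j < n) rnorm (iter j T f) `^ p <=
  4 * 2 `^ p * 2 `^ p * (6 * 8 `^ p) * C `^ (2 * p) * n%:R * rnorm f `^ p.
Proof.
move=> C0 Tacb.
have [g1 [g2 [g3 [g4 [gP fE]]]]] := Lp_decomposition f.
have K0 : 0 <= 6 * 8 `^ p * C `^ (2 * p) * n%:R by rewrite !mulr_ge0 ?powR_ge0.
have bound g : g \in [:: g1; g2; g3; g4] ->
    \sum_(0 <= j < n) rnorm (iter j T g) `^ p <=
    6 * 8 `^ p * C `^ (2 * p) * n%:R * rnorm f `^ p.
  move=> /gP[g0 gf]; apply: le_trans (acb_powR_positive C C0 Tacb n g g0) _.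
  exact: ler_wpM2l.
have one1 : modulus (1 : Defs.scalar R k) <= 1.
  by rewrite /modulus normr1; case: k.
have mone1 : modulus (-1 : Defs.scalar R k) <= 1.
  by rewrite /modulus normrN -/(modulus 1).
(* Two nested combinations: [(2^p * 2)^2] is the factor [4 * 2^p * 2^p]. *)
rewrite [in leLHS]fE; apply: le_trans.
  apply: (acb_powR_comb _ _ _ _ _ _ one1 modulus_imag_unit);
    by apply: (acb_powR_comb _ _ _ _ _ _ one1 mone1); apply: bound;
       rewrite !inE eqxx ?orbT.
move: (C `^ _) (8 `^ p) (2 `^ p) (rnorm f `^ p) => x y z t; lra.
Qed.
End CesaroPower.

(** * Admissible constants and their infimum *)

Section AcbConst.
Context {R : realType} {k : scalar_kind} {X : normedModType (Defs.scalar R k)}.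
Variables (r : R) (T : X -> X).

Lemma acb_constP (C : R) : acb_const r T C <->
  0 < C /\ forall n x,
    \sum_(0 <= j < n) rnorm (iter j T x) `^ r <= C * n%:R * rnorm x `^ r.
Proof.
split=> -[C0 H]; split=> //; [move=> [|n] x|move=> x].
- by rewrite big_geq// mulr0 mul0r.
- have n0 : 0 < n.+1%:R :> R by rewrite ltr0n.
  rewrite big_mkord mulrAC -ler_pdivrMr// mulrC -lee_fin.
  by apply: le_trans (H x); apply: ereal_sup_ubound; exists n.+1.
apply: ge_ereal_sup => _ [n n1 <-]; rewrite lee_fin mulrC ler_pdivrMr ?ltr0n//.
by have := H n x; rewrite big_mkord mulrAC.
Qed.

Lemma acb_min_ge0 : 0 <= acb_min r T.
Proof.
(* The infimum of the empty set is [0] by convention. *)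
rewrite /acb_min; have [->|/set0P ne] := eqVneq [set C | acb_const r T C] set0.
  by rewrite inf0.
by apply: lb_le_inf => // C [/ltW].
Qed.

Lemma acb_min_le (C : R) : acb_const r T C -> acb_min r T <= C.
Proof. by move=> TC; apply: ge_inf => //; exists 0 => x [/ltW]. Qed.

Lemma acb_min_lt (x : R) : acb r T -> acb_min r T < x ->
  exists2 C, acb_const r T C & C < x.
Proof.
move=> [C TC] mx; rewrite -subr_gt0 in mx.
have [|D TD Dx] := @inf_adherent _ [set C | acb_const r T C] _ mx.
  by split; [exists C|exists 0 => y [/ltW]].
by exists D => //; move: Dx; rewrite /acb_min addrC subrK.
Qed.

End AcbConst.

(** * The bound for operators and the comparison of optimal constants *)

Lemma acb_const_powR (R : realType) (p : R) (p1 : 1 < p) (k : scalar_kind)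
    (d : measure_display) (Omega : measurableType d)
    (mu : {measure set Omega -> \bar R})
    (T : {linear Lp k mu (ltW p1) -> Lp k mu (ltW p1)}) (C : R) :
  positive_op T -> acb_const 1 T C ->
  acb_const p T (4 * 2 `^ p * 2 `^ p * (6 * 8 `^ p) * C `^ (2 * p)).
Proof.
move=> Tpos /acb_constP[C0 H]; apply/acb_constP; split.
  by rewrite !mulr_gt0// powR_gt0.
move=> n f; apply: acb_powR => //; first by move=> a g h; rewrite linearP.
  exact: ltW.
move=> m g; have := H m g; rewrite powRr1 ?rnorm_ge0//.
by under eq_bigr do rewrite powRr1 ?rnorm_ge0//.
Qed.

Theorem theorem2p1 (R : realType) (p : R) (p1 : 1 < p) :
  exists2 Cp : R, 0 < Cp &
    forall (k : scalar_kind) (d : measure_display) (Omega : measurableType d)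
      (mu : {measure set Omega -> \bar R})
      (T : {linear Lp k mu (ltW p1) -> Lp k mu (ltW p1)}),
      continuous T -> positive_op T -> acb 1 T ->
      acb p T /\ acb_min p T <= Cp * acb_min 1 T `^ (2 * p).
Proof.
(* The factor [6 * 8^p] comes from the self-improvement for nonnegative functions, the rest from
   recombining four of them. *)
set K : R := 4 * 2 `^ p * 2 `^ p * (6 * 8 `^ p).
have K0 : 0 < K by rewrite !mulr_gt0// powR_gt0.
have p0 : 0 < 2 * p by rewrite mulr_gt0// (lt_trans _ p1).
exists K => // k d Omega mu T _ Tpos T1; have [C TC] := T1; split.
  by exists (K * C `^ (2 * p)); exact: acb_const_powR.
rewrite leNgt; apply/negP => lt.
(* The infimum need not be attained, so argue by contradiction through [x] with
   [K * x^(2p) = acb_min p T]. It exceeds [acb_min 1 T], so some admissible [D < x] exists, and then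
   [acb_min p T <= K * D^(2p) < K * x^(2p)]. *)
set x := (acb_min p T / K) `^ (2 * p)^-1.
have xE : x `^ (2 * p) = acb_min p T / K.
  by rewrite -powRrM mulVf ?gt_eqF// powRr1// divr_ge0 ?acb_min_ge0 ?(ltW K0).
have mx : acb_min 1 T < x.
  rewrite ltNge; apply/negP => /(ge0_ler_powR (ltW p0)).
  rewrite !nnegrE powR_ge0 acb_min_ge0 => /(_ isT isT).
  by rewrite xE ler_pdivrMr// mulrC leNgt lt.
have [D TD Dx] := acb_min_lt _ _ _ T1 mx.
have := acb_min_le _ _ _ (acb_const_powR _ _ p1 _ _ _ _ _ _ Tpos TD).
apply/negP; rewrite -ltNge -/K mulrC -ltr_pdivlMr// -xE.
by apply: gt0_ltr_powR => //; rewrite nnegrE ?powR_ge0// ltW//; case: TD.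
Qed.
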